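(* Let $I=[-1,1]$ and let $F:I\times I\to\mathbb R$ satisfy $F,F'_y\in\mathscr H(I,I)$, $F(0,0)=0$ and $F'_y(0,0)\neq0$. Then there exist an open neighborhood $U_1\times U_2\subset I\times I$ of $(0,0)$ and a unique $f\in\mathcal H^1(U_1)$ with $f(U_1)\subset U_2$ such that for all $(x,y)\in U_1\times U_2$: $F(x,y)=0$ if and only if $y=f(x)$.
   Context: For bounded intervals $I_1,I_2\subset\mathbb R$, $\mathscr H(I_1,I_2)$ is the set of functions $F:I_1\times I_2\to\mathbb R$ such that: (i) $F(x,\cdot)\in C^1(I_2)$ for each fixed $x\in I_1$; (ii) $F(\cdot,y)\in\mathcal H^1(I_1)$ for each fixed $y\in I_2$; (iii) there is $g\in L^2(I_1)$ with $|F'_x(x,y)|\le g(x)$ for all $(x,y)\in I_1\times I_2$. Here $\mathcal H^1(U)$ is the Sobolev space of (absolutely continuous) functions $f$ on $U$ with $f,f'\in L^2(U)$. *)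

(* Defs.v *)
From HB Require Import structures.
From mathcomp Require Import all_boot all_order all_algebra.
From mathcomp Require Import all_classical all_reals all_analysis.
Set Implicit Arguments. Unset Strict Implicit. Unset Printing Implicit Defensive.
Import Order.TTheory GRing.Theory Num.Theory.
Import numFieldNormedType.Exports.
Local Open Scope classical_set_scope.
Local Open Scope ring_scope.

Definition L2_on (R : realType) (D : set R) (f : R -> R) : Prop :=
  measurable_fun D f /\
  (\int[@lebesgue_measure R]_(x in D) ((`|f x| ^+ 2)%:E) < +oo)%E.

Definition abs_cont_on (R : realType) (D : set R) (f : R -> R) : Prop :=
  forall e : R, 0 < e -> exists2 d : R, 0 < d &
    forall (n : nat) (a b : 'I_n -> R),
      (forall i, a i < b i) ->
      (forall i, `[a i, b i]%classic `<=` D) ->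
      (forall i j, i != j -> (b i <= a j) \/ (b j <= a i)) ->
      \sum_(i < n) (b i - a i) < d ->
      \sum_(i < n) `|f (b i) - f (a i)| < e.

(* Sobolev space H^1(D) on an interval D: absolutely continuous functions
   with f and f' (its a.e. derivative) in L^2(D). *)
Definition H1 (R : realType) (D : set R) (f : R -> R) : Prop :=
  abs_cont_on D f /\ L2_on D f /\ L2_on D (derive1 f).

(* l is the derivative of f at x relative to D (one-sided at endpoints of an
   interval D, two-sided at interior points). *)
Definition deriv_within (R : realType) (D : set R) (f : R -> R) (x l : R)
  : Prop :=
  (fun h : R => h^-1 * (f (x + h) - f x)) @
     within [set h | D (x + h)] 0^' --> l.

Definition C1_on (R : realType) (D : set R) (f : R -> R) : Prop :=
  exists f' : R -> R,
    (forall y, D y -> deriv_within D f y (f' y)) /\ {within D, continuous f'}.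

Definition partial_y (R : realType) (I1 I2 : set R) (F Fy : R -> R -> R)
  : Prop :=
  forall x y, I1 x -> I2 y -> deriv_within I2 (F x) y (Fy x y).

Definition Hclass (R : realType) (I1 I2 : set R) (F : R -> R -> R) : Prop :=
  (forall x, I1 x -> C1_on I2 (F x)) /\
  (forall y, I2 y -> H1 I1 (fun x => F x y)) /\
  exists2 g : R -> R, L2_on I1 g &
    forall y, I2 y ->
      {ae @lebesgue_measure R, forall x, I1 x ->
          `|derive1 (fun t => F t y) x| <= g x}.

(* Main.v *)
(** The analytic core is Lebesgue's theorem that an absolutely continuous
    function [f] is the integral of its a.e. derivative.  The total variation
    [V] of [f] is again absolutely continuous, so [V] and [V - f] are
    nondecreasing and absolutely continuous; their Lebesgue-Stieltjes measures
    are dominated by the Lebesgue measure, and the Radon-Nikodym densities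
    recover [f'] by Lebesgue differentiation.  Hence condition (iii) gives
    [|F(x', y) - F(x, y)| <= \int_x^x' g] uniformly in [y], and likewise for
    [F'_y], so [F'_y] is close to [F'_y(0,0)] near the origin.  On a small
    rectangle [F(x, .) / F'_y(0,0)] then has slope at least 1/2, and the
    intermediate value theorem yields a unique root [f(x)].  Comparing
    [F(x', f x')] and [F(x, f x)], both zero, bounds [|f x' - f x|] by a multiple
    of [\int_x^x' g]: this makes [f] absolutely continuous with
    [|f'| <= c g] a.e., so [f'] is square integrable. *)
Require Import Defs.
From HB Require Import structures.
From mathcomp Require Import all_boot all_order all_algebra.
From mathcomp Require Import all_classical all_reals all_analysis.
From mathcomp Require Import measurable_realfun ring lra.
Import Order.TTheory GRing.Theory Num.Theory.
Import numFieldNormedType.Exports.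
Set Implicit Arguments. Unset Strict Implicit. Unset Printing Implicit Defensive.
Local Open Scope classical_set_scope.
Local Open Scope ring_scope.

(** * Absolute continuity: finite families of intervals, extension to the line, refinement *)

Section AbsoluteContinuity.
Context {R : realType}.
Implicit Types (D : set R) (f g : R -> R) (a b : R).

Lemma abs_cont_onP D f : abs_cont_on D f ->
  forall e : R, 0 < e -> exists2 d : R, 0 < d &
    forall (T : finType) (a b : T -> R),
      (forall t, a t <= b t) ->
      (forall t, `[a t, b t]%classic `<=` D) ->
      (forall s t, s != t -> a s < b s -> a t < b t ->
         b s <= a t \/ b t <= a s) ->
      \sum_t (b t - a t) < d ->
      \sum_t `|f (b t) - f (a t)| < e.
Proof.
move=> acf e e0; have [d d0 dP] := acf e e0; exists d => // T a b ab abD disj.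
pose S := [set t | a t < b t]%SET.
have sumS (h : T -> R) : (forall t, a t = b t -> h t = 0) ->
    \sum_t h t = \sum_(i < #|S|) h (enum_val i).
  move=> h0; rewrite -big_enum_val [LHS](bigID (mem S))/= [X in _ + X]big1 ?addr0//.
  move=> t; rewrite inE -leNgt => ba; apply: h0; apply/eqP.
  by rewrite eq_le ab ba.
rewrite sumS; last by move=> t ->; rewrite subrr.
rewrite sumS; last by move=> t ->; rewrite subrr normr0.
apply: (dP _ (fun i => a (enum_val i)) (fun i => b (enum_val i))).
- by move=> i; have := enum_valP i; rewrite inE.
- by move=> i; exact: abD.
- move=> i j ij; apply: disj.
  + by apply: contra ij => /eqP/enum_val_inj ->.
  + by have := enum_valP i; rewrite inE.
  + by have := enum_valP j; rewrite inE.
Qed.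

Lemma abs_cont_onB D f g : abs_cont_on D f -> abs_cont_on D g ->
  abs_cont_on D (f \- g).
Proof.
move=> acf acg e e0.
have e20 : 0 < e / 2 by rewrite divr_gt0.
have [d1 d10 d1P] := acf _ e20; have [d2 d20 d2P] := acg _ e20.
exists (Num.min d1 d2); first by rewrite lt_min d10.
move=> n a b ab abD disj; rewrite lt_min => /andP[/d1P fe /d2P ge].
rewrite [ltRHS]splitr; apply: le_lt_trans (ltrD (fe ab abD disj) (ge ab abD disj)).
rewrite -big_split/=; apply: ler_sum => i _.
rewrite (_ : f (b i) - g (b i) - (f (a i) - g (a i)) =
  (f (b i) - f (a i)) - (g (b i) - g (a i))) ?ler_normB//.
by ring.
Qed.

Lemma abs_cont_on_sub D D' f : D' `<=` D -> abs_cont_on D f -> abs_cont_on D' f.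
Proof.
move=> sD acf e e0; have [d d0 dP] := acf e e0; exists d => // n a b ab abD.
by apply: dP => // i; exact: subset_trans (abD i) sD.
Qed.

(** For [a <= b], the nearest-point projection onto [[a, b]]; composing with it extends a function
    by its end values. *)
Definition clamp a b (x : R) := Num.max a (Num.min b x).

Lemma clamp_itv a b x : a <= b -> a <= clamp a b x <= b.
Proof. by move=> ab; rewrite /clamp le_max lexx/= ge_max ab ge_min lexx. Qed.

Lemma clamp_id a b x : a <= x <= b -> clamp a b x = x.
Proof.
by move=> /andP[ax xb]; rewrite /clamp min_r// max_r.
Qed.

Lemma le_clamp a b x y : x <= y -> clamp a b x <= clamp a b y.
Proof.
move=> xy; rewrite /clamp ge_max le_max lexx/= le_max; apply/orP; right.
by rewrite le_min !ge_min lexx xy orbT.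
Qed.

Lemma clamp_lipschitz a b x y : a <= b -> x <= y ->
  clamp a b y - clamp a b x <= y - x.
Proof.
rewrite /clamp /Num.max /Num.min => ab xy; repeat case: ifPn; rewrite -?leNgt; lra.
Qed.

(** Clamping is monotone and 1-Lipschitz: it keeps intervals non-overlapping and does not increase
    their total length. Some may collapse, whence the use of [abs_cont_onP]. *)
Lemma abs_cont_on_clamp a b f : a <= b -> abs_cont_on `[a, b] f ->
  abs_cont_on setT (f \o clamp a b).
Proof.
move=> ab acf e e0; have [d d0 dP] := abs_cont_onP acf e0; exists d => //.
move=> n u v uv _ disj sd.
apply: (dP _ (clamp a b \o u) (clamp a b \o v)) => //=.
- by move=> i; exact/le_clamp/ltW.
- move=> i x /=; rewrite !in_itv/= => /andP[ux xv].
  have /andP[au _] := clamp_itv (u i) ab; have /andP[_ vb] := clamp_itv (v i) ab.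
  by rewrite (le_trans au)//= (le_trans xv).
- by move=> i j ij _ _; case: (disj _ _ ij) => ?; [left|right]; exact: le_clamp.
- apply: le_lt_trans sd; apply: ler_sum => i _; apply: clamp_lipschitz => //.
  exact/ltW.
Qed.

Lemma abs_cont_on_dist D f : abs_cont_on D f -> forall e : R, 0 < e ->
  exists2 d : R, 0 < d & forall x y, x <= y -> `[x, y] `<=` D -> y - x < d ->
    `|f y - f x| < e.
Proof.
move=> acf e e0; have [d d0 dP] := abs_cont_onP acf e0; exists d => //.
move=> x y xy xyD yx.
have := dP unit (fun=> x) (fun=> y); rewrite !big_const card_unit/= !addr0.
by apply => // -[] [].
Qed.

Lemma abs_cont_on_continuous f : abs_cont_on setT f -> continuous f.
Proof.
move=> acf x; apply/(@cvgrPdist_lt _ R^o) => e e0.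
have [d d0 dP] := abs_cont_on_dist acf e0.
near=> y.
have : `|x - y| < d by near: y; exact: cvgr_dist_lt.
have [xy|yx] := leP x y.
  by rewrite distrC ger0_norm ?subr_ge0// distrC => ?; exact: dP.
by rewrite ger0_norm ?subr_ge0 ?(ltW yx)// => ?; apply: dP => //; exact: ltW.
Unshelve. all: by end_near. Qed.

Lemma itv_partition_le_nth a b s i : itv_partition a b s -> (i <= size s)%N ->
  a <= nth b (a :: s) i <= b.
Proof.
move=> [p /eqP <-] ilt.
have ss : sorted <=%R  (a :: s) by exact: (sub_path (fun x y => @ltW _ _ x y) p).
have hm k j : (k <= j <= size s)%N ->
    nth (last a s) (a :: s) k <= nth (last a s) (a :: s) j.
  move=> /andP[kj js].
  by apply: (sorted_leq_nth le_trans le_refl) => //; rewrite inE ltnS// (leq_trans kj).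
rewrite -{1}[a]/(nth (last a s) (a :: s) 0) hm//=.
by rewrite (le_trans (hm _ (size s) _)) ?ilt ?leqnn//= -last_nth.
Qed.

Lemma itv_partition_lt_nth a b s i j : itv_partition a b s ->
  (i < j <= size s)%N -> nth b (a :: s) i < nth b (a :: s) j.
Proof.
move=> [p _] /andP[ij js].
by apply: (sorted_ltn_nth lt_trans) => //; rewrite inE ltnS// (leq_trans (ltnW ij)).
Qed.

(* Refining each interval of the family by a partition whose variation nearly
   attains the total variation yields another admissible family for [f]. *)
Lemma abs_cont_on_TV_sum D f : abs_cont_on D f ->
  forall e : R, 0 < e -> exists2 d : R, 0 < d &
    forall (n : nat) (a b : 'I_n -> R),
      (forall i, a i < b i) ->
      (forall i, `[a i, b i]%classic `<=` D) ->
      (forall i j, i != j -> (b i <= a j) \/ (b j <= a i)) ->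
      \sum_(i < n) (b i - a i) < d ->
      (forall s : 'I_n -> seq R, (forall i, itv_partition (a i) (b i) (s i)) ->
      \sum_(i < n) variation (a i) (b i) f (s i) < e).
Proof.
move=> acf e e0; have [d d0 dP] := abs_cont_onP acf e0; exists d => //.
move=> n a b ab abD disj sd s sP.
(* An index is an interval together with one piece of its partition. [N i 0] is [a i], so piece [k]
   runs from [N i k] to [N i k.+1]. *)
pose T : finType := {i : 'I_n & 'I_(size (s i))}.
pose N i k := nth (b i) (a i :: s i) k.
pose u (t : T) := N (tag t) (tagged t).
pose v (t : T) := N (tag t) (tagged t).+1.
have sumE (h : forall i, nat -> R) : \sum_(t : T) h (tag t) (tagged t) =
    \sum_(i < n) \sum_(0 <= k < size (s i)) h i k.
  rewrite -(sig_big_dep xpredT (fun i _ => true)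
    (fun (i : 'I_n) (k : 'I_(size (s i))) => h i k))/=.
  by apply: eq_bigr => i _; rewrite big_mkord.
have uab (t : T) : a (tag t) <= u t <= b (tag t).
  by apply: itv_partition_le_nth => //; exact/ltnW.
have vab (t : T) : a (tag t) <= v t <= b (tag t).
  exact: itv_partition_le_nth.
have uv (t : T) : u t < v t by apply: itv_partition_lt_nth; rewrite ?ltnSn/=.
rewrite (_ : \sum_(i < n) _ = \sum_t `|f (v t) - f (u t)|); last first.
  by rewrite (sumE (fun i k => `|f (N i k.+1) - f (N i k)|)).
apply: dP.
- by move=> t; exact/ltW.
- move=> t x /=; rewrite in_itv/= => /andP[ux xv]; apply: (abD (tag t)).
  have /andP[au _] := uab t; have /andP[_ vb] := vab t.
  by rewrite /= in_itv/= (le_trans au)//= (le_trans xv).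
- move=> t t' tt' _ _.
  (* Pieces of different intervals are separated by [disj]; pieces of the same interval are ordered
     by their indices. *)
  have [tagE|/eqP tagN] := pselect (tag t = tag t'); last first.
    have /andP[au ub] := uab t; have /andP[av vb] := vab t.
    have /andP[au' ub'] := uab t'; have /andP[av' vb'] := vab t'.
    case: (disj _ _ tagN) => ba; [left|right].
      by rewrite (le_trans vb)// (le_trans ba).
    by rewrite (le_trans vb')// (le_trans ba).
  have le_uv i (k k' : nat) : (k < k')%N -> (k' < size (s i))%N -> N i k.+1 <= N i k'.
    rewrite leq_eqVlt => /predU1P[<-//|kk'] k's; apply/ltW.
    by apply: itv_partition_lt_nth; rewrite ?kk'//= ltnW.
  case: t t' tt' tagE {uab vab uv} => [i k] [j l]/= + ij.
  rewrite /u /v/=; case: _ / ij l => l kl.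
  have [kltl|] := ltnP k l; first by left; exact: le_uv.
  rewrite leq_eqVlt => /predU1P[lk|lk]; last by right; exact: le_uv.
  by move: kl; rewrite (_ : l = k) ?eqxx//; exact: val_inj.
- rewrite (sumE (fun i k => N i k.+1 - N i k)); apply: le_lt_trans sd.
  apply: ler_sum => i _; rewrite telescope_sumr// /N/= lerD2r.
  have /andP[_] := itv_partition_le_nth (sP i) (leqnn _).
  by [].
Qed.

End AbsoluteContinuity.

(** * Total variation of an absolutely continuous function *)

Section TotalVariation.
Context {R : realType}.
Implicit Types (f : R -> R) (a b x y : R).
Local Notation BV := bounded_variation.
Local Notation TV := total_variation.

(** On an interval shorter than the [d] associated with 1, every variation is below 1. Finitely many
    steps of length [d / 2] cover [[a, b]], and total variation is additive. *)
Lemma abs_cont_on_BV a b f : a <= b -> abs_cont_on `[a, b] f -> BV a b f.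
Proof.
move=> ab /abs_cont_on_TV_sum /(_ 1 ltr01)[d d0 dP].
have small x y : a <= x -> x <= y -> y <= b -> y - x < d -> BV x y f.
  move=> ax; rewrite le_eqVlt => /predU1P[<- *|xy yb yx].
    exact: bounded_variationxx.
  exists 1 => _ [s xys <-]; apply/ltW.
  have := dP 1%N (fun=> x) (fun=> y); rewrite big_ord1 => /(_ _ _ _ yx (fun=> s)).
  rewrite big_ord1; apply => //.
    move=> _ z /=; rewrite !in_itv/= => /andP[xz zy].
    by rewrite (le_trans ax)//= (le_trans zy).
  by move=> i j; rewrite !ord1 eqxx.
have d20 : 0 < d / 2 by rewrite divr_gt0.
have step n : forall x y, a <= x -> x <= y -> y <= b ->
    y - x <= n%:R * (d / 2) -> BV x y f.
  elim: n => [x y ax xy yb|n IH x y ax xy yb].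
    by rewrite mul0r => yx; apply: small => //; apply: le_lt_trans yx _.
  rewrite -natr1 mulrDl mul1r => yx.
  have [?|dyx] := ltP (y - x) d; first exact: small.
  pose z := y - d / 2.
  have xz : x <= z by rewrite /z; move: dyx d20; lra.
  have zy : z <= y by rewrite /z; move: d20; lra.
  apply/bounded_variationP => //; rewrite (@total_variationD _ x y z)//.
  rewrite fin_numD; apply/andP; split; apply/bounded_variationP => //.
    by apply: IH => //; [exact: le_trans yb|rewrite /z; move: yx; lra].
  by apply: small => //; [exact: le_trans xz|rewrite /z; move: d20; lra].
apply: (step (Num.Def.archi_bound ((b - a) / (d / 2)))) => //.
by rewrite -ler_pdivrMr//; apply/ltW/archi_boundP; rewrite divr_ge0 ?subr_ge0// ltW.
Qed.

Lemma fine_total_variationB a b f x y : BV a b f ->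
  a <= x -> x <= y -> y <= b ->
  fine (TV a y f) - fine (TV a x f) = fine (TV x y f).
Proof.
move=> bvf ax xy yb; have ab : a <= b by rewrite (le_trans ax)// (le_trans xy).
have finl : TV a x f \is a fin_num.
  apply/bounded_variationP => //.
  exact: bounded_variationl (le_trans xy yb) bvf.
have finr : TV x y f \is a fin_num.
  apply/bounded_variationP => //; apply: (bounded_variationr ax xy).
  exact: bounded_variationl (le_trans ax xy) yb bvf.
rewrite (total_variationD f ax xy) (fineD finl finr).
by rewrite [X in X - _]addrC addrK.
Qed.

(** The increment of the total variation over an interval is nearly attained by a partition of it,
    and [abs_cont_on_TV_sum] controls all these partitions at once. *)
Lemma abs_cont_on_total_variation a b f : a <= b -> abs_cont_on `[a, b] f ->
  abs_cont_on `[a, b] (fun x => fine (TV a x f)).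
Proof.
move=> ab acf e e0; have bvf := abs_cont_on_BV ab acf.
have e20 : 0 < e / 2 by rewrite divr_gt0.
have [d d0 dP] := abs_cont_on_TV_sum acf e20; exists d => // n u v uv uvab dj sd.
have itvuv i : (a <= u i) && (v i <= b).
  have ui : `[a, b]%classic (u i).
    by apply: (uvab i); rewrite /= in_itv/= lexx ltW.
  have vi : `[a, b]%classic (v i).
    by apply: (uvab i); rewrite /= in_itv/= lexx ltW.
  by move: ui vi; rewrite /= !in_itv/= => /andP[-> _] /andP[_ ->].
(* The allowed error per interval: [n] of them add up to at most [e / 2], and [n.+1] is nonzero even
   for an empty family. *)
pose r := e / 2 / n.+1%:R; have r0 : 0 < r by rewrite divr_gt0.
have sP i : exists s, itv_partition (u i) (v i) s /\
    fine (TV (u i) (v i) f) - r < variation (u i) (v i) f s.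
  have /andP[aui vib] := itvuv i.
  have finTV : TV (u i) (v i) f \is a fin_num.
    apply/bounded_variationP; first exact: ltW.
    apply: (bounded_variationr aui (ltW (uv i))).
    by apply: bounded_variationl bvf => //; rewrite (le_trans aui)// ltW.
  have [_ [_ [s sp <-] <-]] := ub_ereal_sup_adherent r0 finTV.
  rewrite -/(TV _ _ _) -(fineK finTV) -EFinB lte_fin => lts.
  by exists s.
have [s {}sP] := choice sP.
apply: (@le_lt_trans _ _ (\sum_(i < n) (variation (u i) (v i) f (s i) + r))).
  apply: ler_sum => i _; have /andP[aui vib] := itvuv i.
  rewrite (fine_total_variationB bvf)//; last exact: ltW.
  rewrite ger0_norm ?fine_ge0 ?total_variation_ge0 ?ltW//.
  by have [_] := sP i; rewrite ltrBlDr.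
rewrite big_split/= [ltRHS]splitr; apply: ltr_leD.
  by apply: dP => // i; have [] := sP i.
have -> : e / 2 = r * n.+1%:R by rewrite /r divfK.
by rewrite sumr_const card_ord -[leLHS]mulr_natr ler_pM2l// ler_nat.
Qed.

End TotalVariation.

(** * Absolutely continuous functions as integrals of a density *)

Section Density.
Context {R : realType}.
Local Notation mu := (@lebesgue_measure R).
Implicit Types (f : R -> R) (a b x y : R).

Lemma lebesgue_stieltjes_itvoc (F : cumulative R R) a b : a <= b ->
  lebesgue_stieltjes_measure F `]a, b]%classic = (F b - F a)%:E.
Proof.
move=> ab; rewrite /lebesgue_stieltjes_measure/= /measure_extension/=.
rewrite measurable_mu_extE/=; last exact: is_ocitv.
by rewrite wlength_itv_bnd.
Qed.

(** Finite measure excludes unbounded intervals; otherwise the endpoints are the infimum and the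
    supremum. Allowing [a = b] covers the empty set. *)
Lemma open_interval_itvoo (I : set R) : open I -> is_interval I ->
  (mu I < +oo)%E -> exists a b, a <= b /\ I = `]a, b[%classic.
Proof.
move=> oI iI muI; have IE := (interior_id I).1 oI.
have [I0|/set0P I0] := eqVneq I set0.
  by exists 0, 0; split => //; rewrite I0 set_itvoo0.
have [lI|lI] := pselect (has_lbound I); have [uI|uI] := pselect (has_ubound I).
- exists (inf I), (sup I); split.
    by have [x Ix] := I0; apply: le_trans (ub_le_sup uI Ix); exact: ge_inf.
  by rewrite -{1}IE interval_bounded_interior// set_itvoo.
- move: muI; rewrite -IE interval_right_unbounded_interior// -set_itvoy.
  by rewrite lebesgue_measure_itv/= ltry.
- move: muI; rewrite -IE interval_left_unbounded_interior// -set_itvNyo.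
  by rewrite lebesgue_measure_itv/= ltNyr.
- move: muI; rewrite (interval_unbounded_setT iI lI uI) -set_itvNyy.
  by rewrite lebesgue_measure_itv/=.
Qed.

(** By outer regularity a null set lies in an open set of measure below [d]. This open set is a
    countable disjoint union of open intervals, and absolute continuity bounds the Stieltjes measure
    of each finite subfamily by [e]. *)
Lemma lebesgue_stieltjes_dominates (F : cumulative R R) : abs_cont_on setT F ->
  lebesgue_stieltjes_measure F `<< mu.
Proof.
move=> acF; apply/null_content_dominatesP => A mA A0.
apply/eqP; rewrite eq_le measure_ge0 andbT.
apply/lee_addgt0Pr => e e0; rewrite add0e.
have [d d0 dP] := abs_cont_onP acF e0.
have muAoo : (mu A < +oo)%E by rewrite A0 ltry.
have [U [oU AU muUA]] := lebesgue_regularity_outer mA muAoo d0.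
have mU : measurable U by exact: measurable_realfun.open_measurable.
have muU : (mu U < d%:E)%E.
  rewrite -(setDUK AU) measureU//; last 2 first.
  - exact: measurableD.
  - by rewrite setDIK.
  by rewrite A0 add0e.
pose I := open_disjoint_itv oU.
have mI i : measurable (I i).
  by apply: measurable_realfun.open_measurable; exact: open_disjoint_itv_open.
have UE : U = \bigcup_i I i by exact: open_disjoint_itv_bigcup.
have tI : trivIset setT I by exact: open_disjoint_itv_trivIset.
have IU i : I i `<=` U by rewrite UE; exact: bigcup_sup.
have abP i : exists ab : R * R, ab.1 <= ab.2 /\ I i = `]ab.1, ab.2[%classic.
  have [|||u [v uvE]] := @open_interval_itvoo (I i).
  - exact: open_disjoint_itv_open.
  - exact: open_disjoint_itv_is_interval.
  - apply: (@le_lt_trans _ _ (mu U)); last by rewrite (lt_trans muU)// ltry.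
    by apply: le_measure; [rewrite inE; exact: mI|rewrite inE; exact: mU|].
  - by exists (u, v).
have [ab {}abP] := choice abP.
apply: (@le_trans _ _ (lebesgue_stieltjes_measure F U)).
  by apply: le_measure => //; rewrite inE.
rewrite [in leLHS]UE measure_semi_bigcup//; last by rewrite -UE.
apply: lime_le; first by apply: is_cvg_nneseries => *; exact: measure_ge0.
apply: nearW => n.
(* Each open interval is enlarged to a half-open one, whose Stieltjes measure is exactly the
   increment of [F]. *)
apply: (@le_trans _ _ (\sum_(i < n) (F (ab i).2 - F (ab i).1)%:E)%E).
  rewrite big_mkord; apply: lee_sum => i _; have [abi IE] := abP i.
  rewrite -lebesgue_stieltjes_itvoc// IE.
  apply: le_measure; rewrite ?inE; do ?exact: measurable_itv.
  by apply: subset_itvl; rewrite bnd_simp.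
rewrite sumEFin lee_fin; apply/ltW.
apply: (@le_lt_trans _ _ (\sum_(i < n) `|F (ab i).2 - F (ab i).1|)).
  by apply: ler_sum => i _; exact: ler_norm.
apply: (dP 'I_n (fun i => (ab i).1) (fun i => (ab i).2)).
- by move=> i; have [] := abP i.
- by [].
- move=> i j ij abi abj; have [_ Ii] := abP i; have [_ Ij] := abP j.
  have : I i `&` I j = set0.
    move/trivIsetP : tI; apply => //; by apply: contra ij => /eqP/val_inj ->.
  rewrite Ii Ij => Iij.
  have [?|lt1] := leP (ab i).2 (ab j).1; first by left.
  have [?|lt2] := leP (ab j).2 (ab i).1; first by right.
  (* If the intervals overlapped, the midpoint of their intersection []m, M[] would lie in the empty
     set. *)
  exfalso; pose m := Num.max (ab i).1 (ab j).1; pose M := Num.min (ab i).2 (ab j).2.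
  have mM : m < M by rewrite lt_min !gt_max abi lt2 lt1 abj.
  suff : set0 ((m + M) / 2) by [].
  have mm : m < (m + M) / 2 by rewrite midf_lt.
  have MM : (m + M) / 2 < M by rewrite midf_lt.
  move: mm MM; rewrite gt_max lt_min => /andP[m1 m2] /andP[M1 M2].
  by rewrite -Iij; split; rewrite /= in_itv/= ?m1 ?m2.
- rewrite -lte_fin -sumEFin; apply: le_lt_trans muU.
  rewrite UE measure_semi_bigcup//; last by rewrite -UE.
  apply: le_trans (nneseries_lim_ge n _) => //.
  rewrite big_mkord; apply: lee_sum => i _; have [abi IE] := abP i.
  rewrite IE [leRHS]lebesgue_measure_itv/= lte_fin; case: ifPn => //.
  by rewrite -leNgt => ba; rewrite lee_fin subr_le0.
Qed.


Lemma nondecreasing_abs_cont_density f a b : nondecreasing f ->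
  abs_cont_on setT f ->
  exists2 h : R -> R, mu.-integrable setT (EFin \o h) &
    forall x y, a <= x -> x <= y -> y <= b ->
      f y - f x = \int[mu]_(t in `]x, y]) h t.
Proof.
move=> ndf acf; have cf := abs_cont_on_continuous acf.
have rcf : right_continuous f by move=> x; exact/cvg_at_right_filter/cf.
pose F : cumulative R R := HB.pack f (isCumulative.Build R _ R f ndf rcf).
have [ab|ba] := leP a b; last first.
  exists (cst 0); first exact: integrable0.
  by move=> x y ax xy yb; move: ba; rewrite ltNge (le_trans ax)// (le_trans xy).
have mab : measurable (`]a, b]%classic : set (measurableTypeR R)).
  exact: measurable_itv.
have Fab : (lebesgue_stieltjes_measure F `]a, b]%classic < +oo)%E.
  by rewrite lebesgue_stieltjes_itvoc// ltry.
(* Restricting the Stieltjes measure to []a, b]] makes it finite, so its Radon-Nikodym density is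
   integrable on the whole line. *)
pose nu := mfrestr mab Fab.
have numu : nu `<< mu.
  apply/null_content_dominatesP => A mA A0; rewrite /nu /mfrestr /mrestr.
  have /null_content_dominatesP := lebesgue_stieltjes_dominates (F := F) acf.
  apply; first exact: measurableI.
  by apply: subset_measure0 A0 => //; exact: measurableI.
have [h [h0 hfin hint hE]] :=
  @radon_nikodym_sigma_finite _ _ R mu (mfrestr mab Fab) numu.
have hK : EFin \o (fine \o h) = h by apply/funext => x /=; rewrite fineK.
exists (fine \o h); first by rewrite hK; exact: hint.
move=> x y ax xy yb; rewrite /Rintegral -[RHS]/(fine _).
have : nu `]x, y]%classic = (f y - f x)%:E.
  rewrite /nu /mfrestr /mrestr (setIidl _); last first.
    by apply: subset_itv; rewrite bnd_simp.
  exact: lebesgue_stieltjes_itvoc.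
rewrite /nu hE; last exact: measurable_itv.
move=> /(congr1 fine)/= <-; congr fine.
by apply: eq_integral => t _ /=; rewrite fineK.
Qed.

(** The density is the difference of those of [V] and [V \- f], which are nondecreasing by [VB];
    clamping extends both to the line. *)
Lemma abs_cont_density f a b : a <= b -> abs_cont_on `[a, b] f ->
  exists2 h : R -> R, mu.-integrable setT (EFin \o h) &
    forall x y, a <= x -> x <= y -> y <= b ->
      f y - f x = \int[mu]_(t in `]x, y]) h t.
Proof.
move=> ab acf; have bvf := abs_cont_on_BV ab acf.
pose V x := fine (total_variation a x f).
have acV : abs_cont_on `[a, b] V := abs_cont_on_total_variation ab acf.
have VB x y : a <= x -> x <= y -> y <= b -> `|f y - f x| <= V y - V x.
  move=> ax xy yb; rewrite (fine_total_variationB bvf)//.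
  rewrite -lee_fin fineK ?total_variation_ge//.
  apply/bounded_variationP => //; apply: (bounded_variationr ax xy).
  by apply: bounded_variationl bvf => //; exact: le_trans xy.
have ndV : nondecreasing (V \o clamp a b).
  move=> x y xy /=; rewrite -subr_ge0; apply: le_trans (VB _ _ _ _ _) => //.
  - by have /andP[] := clamp_itv x ab.
  - exact: le_clamp.
  - by have /andP[] := clamp_itv y ab.
have ndVf : nondecreasing ((V \- f) \o clamp a b).
  move=> x y xy /=.
  have := VB (clamp a b x) (clamp a b y).
  have /andP[-> _] := clamp_itv x ab; have /andP[_ ->] := clamp_itv y ab.
  rewrite le_clamp// => /(_ isT isT isT).
  by have := ler_norm (f (clamp a b y) - f (clamp a b x)); lra.
have [h1 ih1 h1E] := nondecreasing_abs_cont_density a b ndV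
  (abs_cont_on_clamp ab acV).
have [h2 ih2 h2E] := nondecreasing_abs_cont_density a b ndVf
  (abs_cont_on_clamp ab (abs_cont_onB acV acf)).
exists (h1 \- h2); first exact: (integrableB measurableT ih1 ih2).
move=> x y ax xy yb; have mxy : measurable (`]x, y]%classic : set R).
  exact: measurable_itv.
rewrite RintegralB//; [|exact: integrableS ih1|exact: integrableS ih2].
have xab : a <= x <= b by rewrite ax (le_trans xy).
have yab : a <= y <= b by rewrite yb (le_trans ax).
rewrite -h1E// -h2E//= !clamp_id//; lra.
Qed.

End Density.

(** * Integral bounds on increments versus pointwise bounds on derivatives *)

Section DerivativeBounds.
Context {R : realType}.
Local Notation mu := (@lebesgue_measure R).
Implicit Types (f g h : R -> R) (a b x y : R).

Lemma derivable_derive1_cvg f x : derivable f x 1 ->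
  h^-1 *: (f (h + x) - f x) @[h --> 0^'] --> derive1 f x.
Proof.
move=> /cvg_ex[l fl].
have fl' : h^-1 *: (f (h + x) - f x) @[h --> 0^'] --> l.
  by move: fl; under eq_fun do rewrite /= [_ *: 1]mulr1.
by rewrite (_ : derive1 f x = l)//; exact: cvg_lim fl'.
Qed.

Lemma density_derive_ae f h a b : mu.-integrable setT (EFin \o h) ->
  (forall x y, a <= x -> x <= y -> y <= b ->
      f y - f x = \int[mu]_(t in `]x, y]) h t) ->
  {ae mu, forall x, a < x < b -> derivable f x 1 /\ derive1 f x = h x}.
Proof.
move=> ih fh.
have ihy y : mu.-integrable [set` Interval (BRight a) (BRight y)] (EFin \o h).
  by apply: integrableS ih => //; exact: measurable_itv.
have lh : locally_integrable setT h.
  by apply: open_integrable_locally => //; exact: openT.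
have := FTC1 ihy lh; apply: filterS; first exact: (ae_filter_ringOfSetsType mu).
move=> x Fx /andP[ax xb].
have {Fx} [dF F'x] := Fx ax.
pose G y := f a + \int[mu]_(t in `]a, y]) h t.
(* Differentiation of the integral applies to [G], which coincides with [f] only on [[a, b]]; near
   an interior point this suffices. *)
have GE : \forall y \near x, G y = f y.
  near=> y.
  have ay : a < y by near: y; exact: lt_nbhsr.
  have yb : y < b by near: y; exact: lt_nbhsl.
  by rewrite /G -fh ?subrKC// ltW.
have dG : is_derive x 1 G (h x).
  rewrite -F'x derive1E -[X in is_derive _ _ _ X]add0r.
  by apply: is_deriveD; exact: derivableP.
have df := near_eq_is_derive GE dG.
by split => //; rewrite derive1E derive_val.
Unshelve. all: by end_near. Qed.

Lemma abs_cont_derivable_ae f a b : a <= b -> abs_cont_on `[a, b] f ->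
  {ae mu, forall x, a < x < b -> derivable f x 1}.
Proof.
move=> ab acf; have [h ih fh] := abs_cont_density ab acf.
have := density_derive_ae ih fh.
apply: filterS; first exact: (ae_filter_ringOfSetsType mu).
by move=> x /[apply] -[].
Qed.

(** The increment is the integral of the density [h], and [h] equals the derivative almost
    everywhere. *)
Lemma abs_cont_increment_le f g a b : a <= b -> abs_cont_on `[a, b] f ->
  mu.-integrable setT (EFin \o g) ->
  {ae mu, forall x, a <= x <= b -> `|derive1 f x| <= g x} ->
  forall x y, a <= x -> x <= y -> y <= b ->
    `|f y - f x| <= \int[mu]_(t in `]x, y]) `|g t|.
Proof.
move=> ab acf ig fg x y ax xy yb; have [h ih fh] := abs_cont_density ab acf.
have mxy : measurable (`]x, y]%classic : set (measurableTypeR R)).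
  exact: measurable_itv.
have ihxy : mu.-integrable `]x, y] (EFin \o h) by exact: integrableS ih.
have igxy : mu.-integrable `]x, y] (EFin \o g) by exact: integrableS ig.
rewrite fh//; apply: le_trans; first exact: (le_normr_Rintegral mxy ihxy).
have ihn : mu.-integrable `]x, y] (fun t => `|h t|%:E).
  exact: (integrable_norm ihxy).
have ign : mu.-integrable `]x, y] (fun t => `|g t|%:E).
  exact: (integrable_norm igxy).
apply: fine_le.
- exact: integrable_fin_num ihn.
- exact: integrable_fin_num ign.
apply: (@ae_ge0_le_integral _ _ _ mu _ mxy (fun t => `|h t|%:E)
  (fun t => `|g t|%:E)).
- by move=> t _; rewrite lee_fin.
- exact: measurable_int ihn.
- by move=> t _; rewrite lee_fin.
- exact: measurable_int ign.
(* The density is identified with the derivative only inside []a, b[], whereas []x, y]] contains [b]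
   when [y = b]. *)
have nb : {ae mu, forall t, t != b}.
  exists [set b]; split; [exact: measurable_set1|exact: lebesgue_measure_set1|].
  by move=> t /= /negP; rewrite negbK => /eqP.
have := density_derive_ae ih fh; move: fg nb.
apply: filterS3; first exact: (ae_filter_ringOfSetsType mu).
move=> t fg tb dh; rewrite /= in_itv/= => /andP[xt ty].
have atb : a < t < b.
  by rewrite (le_lt_trans ax xt)/= lt_neqAle tb (le_trans ty yb).
have [_ <-] := dh atb; rewrite lee_fin (le_trans _ (ler_norm _))//.
by apply: fg; case/andP: atb => /ltW -> /ltW ->.
Qed.

(** The difference quotients of [f] are dominated by those of the indefinite integral [G] of [|g|],
    whose derivative is [|g|] almost everywhere; the bound passes to the limit. *)
Lemma increment_le_derive_ae f g a b : a <= b -> abs_cont_on `[a, b] f ->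
  mu.-integrable setT (EFin \o g) ->
  (forall x y, a <= x -> x <= y -> y <= b ->
    `|f y - f x| <= \int[mu]_(t in `]x, y]) `|g t|) ->
  {ae mu, forall x, a < x < b -> `|derive1 f x| <= `|g x|}.
Proof.
move=> ab acf ig fg.
have ign : mu.-integrable setT (EFin \o (fun t => `|g t|)).
  exact: (integrable_norm ig).
pose G y := \int[mu]_(t in `]a, y]) `|g t|.
have GB x y : a <= x -> x <= y -> y <= b ->
    G y - G x = \int[mu]_(t in `]x, y]) `|g t|.
  move=> ax xy yb; rewrite /G Rintegral_itvB ?bnd_simp//.
  by apply: integrableS ign => //; exact: measurable_itv.
have := density_derive_ae ign GB.
have := abs_cont_derivable_ae ab acf.
apply: filterS2; first exact: (ae_filter_ringOfSetsType mu).
move=> x dfx dGx axb; have [dG <-] := dGx axb; have df := dfx axb.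
have /andP[ax xb] := axb.
have cf : `|k^-1 *: (f (k + x) - f x)| @[k --> 0^'] --> `|derive1 f x|.
  by apply: cvg_norm; exact: derivable_derive1_cvg.
have fG y z : a <= y -> y <= z -> z <= b -> `|f z - f y| <= G z - G y.
  by move=> ay yz zb; rewrite GB// fg.
apply: (ler_cvg_to cf (derivable_derive1_cvg dG)).
near=> k.
have k0 : k != 0 by near: k; exact: nbhs_dnbhs_neq.
have ak : a < k + x.
  rewrite -ltrBlDr; near: k; apply: nbhs_dnbhs; apply: lt_nbhsr.
  by rewrite subr_lt0.
have kb : k + x < b.
  rewrite -ltrBrDr; near: k; apply: nbhs_dnbhs; apply: lt_nbhsl.
  by rewrite subr_gt0.
rewrite /GRing.scale/= normrM normfV.
have [k_lt0|k_gt0|k00] := ltgtP k 0; last by rewrite k00 eqxx in k0.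
- rewrite (ltr0_norm k_lt0) -[k^-1 in leRHS]opprK -invrN mulNr -mulrN opprB.
  rewrite distrC ler_pM2l ?invr_gt0 ?oppr_gt0//.
  by apply: fG; rewrite ?(ltW ak) ?(ltW xb)// gerDr ltW.
- rewrite (gtr0_norm k_gt0) ler_pM2l ?invr_gt0//.
  by apply: fG; rewrite ?(ltW ax) ?(ltW kb)// lerDr ltW.
Unshelve. all: by end_near. Qed.

(** This is absolute continuity of the integral, applied to the union of the intervals. *)
Lemma increment_le_abs_cont f g a b : mu.-integrable setT (EFin \o g) ->
  (forall x y, a <= x -> x <= y -> y <= b ->
    `|f y - f x| <= \int[mu]_(t in `]x, y]) `|g t|) ->
  abs_cont_on `[a, b] f.
Proof.
move=> ig fg e e0; have [d [d0 dP]] := integral_normr_continuous ig e0.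
exists d => // n u v uv uvab disj sd.
have itvuv i : (a <= u i) && (v i <= b).
  have ui : `[a, b]%classic (u i).
    by apply: (uvab i); rewrite /= in_itv/= lexx ltW.
  have vi : `[a, b]%classic (v i).
    by apply: (uvab i); rewrite /= in_itv/= lexx ltW.
  by move: ui vi; rewrite /= !in_itv/= => /andP[-> _] /andP[_ ->].
(* Half-open intervals stay disjoint even when the given ones share an endpoint. *)
pose I i : set R := `]u i, v i]%classic.
have mI i : measurable (I i) by exact: measurable_itv.
have tI : trivIset setT I.
  apply/trivIsetP => i j _ _ ij; apply/seteqP; split => // x [].
  rewrite /I /= !in_itv/= => /andP[ux xv] /andP[u'x xv'].
  by case: (disj _ _ ij) => ?; lra.
have ign : mu.-integrable setT (fun t => `|g t|%:E).
  exact: (integrable_norm ig).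
have mU : measurable (\big[setU/set0]_(i < n) I i).
  exact: bigsetU_measurable.
apply: le_lt_trans (dP _ mU _); last first.
  rewrite [ltLHS]measure_bigsetU_ord//.
  apply: le_lt_trans (_ : ((\sum_(i < n) (v i - u i))%:E < _)%E); last first.
    by rewrite lte_fin.
  rewrite -sumEFin; apply: lee_sum => i _.
  by rewrite [leLHS]lebesgue_measure_itv/= lte_fin uv -EFinB.
rewrite /Rintegral ge0_integral_bigsetU//; last 3 first.
- exact: index_enum_uniq.
- exact: sub_trivIset tI.
- by case/integrableP: ign => + _; exact: measurable_funS.
rewrite -sum_fine; last first.
  move=> i _; apply: integrable_fin_num; first exact: mI.
  by apply: integrableS ign => //; exact: mI.
apply: ler_sum => i _; have /andP[aui vib] := itvuv i.
by apply: fg => //; exact: ltW.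
Qed.

(** On a bounded interval [1 + |g|^2] is integrable, and it dominates [|g|] because
    [(t - 1)^2 >= 0]. *)
Lemma L2_on_integrable g a b : L2_on `[a, b] g ->
  mu.-integrable setT (EFin \o (g \_ `[a, b])).
Proof.
move=> [mg ig]; have mab : measurable (`[a, b]%classic : set (measurableTypeR R)).
  exact: measurable_itv.
rewrite -restrict_EFin; apply: (integrable_mkcond _ mab).1.
have i1 : mu.-integrable `[a, b] (cst 1%:E).
  apply/integrableP; split; first exact: measurable_cst.
  rewrite (eq_integral (cst 1%:E)); last by move=> x _ /=; rewrite normr1.
  rewrite integral_cst//= mul1e lebesgue_measure_itv/=.
  by case: ifPn => // _; rewrite -EFinB ltry.
have i2 : mu.-integrable `[a, b] (fun x => (`|g x| ^+ 2)%:E).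
  apply/integrableP; split.
    by apply/measurable_EFinP/measurable_funX; exact: measurableT_comp.
  apply: le_lt_trans ig; rewrite le_eqVlt; apply/predU1P; left.
  by apply: eq_integral => x _ /=; rewrite ger0_norm// exprn_ge0.
have i3 := integrableD mab i1 i2.
apply: le_integrable i3 => //; first exact/measurable_EFinP.
move=> x _ /=; rewrite lee_fin; have t0 := normr_ge0 (g x).
set t := `|g x| in t0 *; rewrite [leRHS]ger0_norm ?addr_ge0 ?exprn_ge0//.
by have := sqr_ge0 (t - 1); rewrite sqrrB mulr1 expr1n mulr2n; move: t0; lra.
Qed.

End DerivativeBounds.

(** * Measurability of the derivative of a continuous function *)

Section MeasurableDerivative.
Context {R : realType}.
Implicit Types (f : R -> R) (x y : R).

Let quot f (k x : R) : R := k^-1 *: (f (k + x) - f x).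

Let quot_continuous f k : continuous f -> continuous (quot f k).
Proof.
move=> cf x; apply: cvgZl_tmp; apply: cvgB; last exact: cf.
apply: (@continuous_comp _ _ _ (fun y => k + y) f); last exact: cf.
by apply: cvgD; [exact: cvg_cst|exact: cvg_id].
Qed.

(* Cauchy's criterion for the difference quotients; for fixed [m] and [n] the
   inner condition on [x] is closed. *)
Let quot_cauchy f (m n : nat) : set R :=
  \bigcap_(p in [set p : R * R | [/\ p.1 != 0, p.2 != 0,
      `|p.1| < n.+1%:R^-1 & `|p.2| < n.+1%:R^-1]])
    [set x | `|quot f p.1 x - quot f p.2 x| <= m.+1%:R^-1].

Let derivableE f :
  [set x | derivable f x 1] = \bigcap_m \bigcup_n quot_cauchy f m n.
Proof.
apply/seteqP; split => x.
  move=> /derivable_derive1_cvg fx m _.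
  have e0 : 0 < m.+1%:R^-1 / 2 :> R by rewrite divr_gt0.
  have /cvgrPdist_lt/(_ _ e0) := fx.
  move=> [d /= d0 dP].
  have [n nd] : exists n, n.+1%:R^-1 < d.
    exists (Num.truncn d^-1); rewrite invf_plt ?posrE//.
    by rewrite truncnS_gt.
  exists n => // -[p q] /= [p0 q0 pn qn].
  have := dP p; have := dP q; rewrite /= !sub0r !normrN.
  move=> /(_ (lt_trans qn nd) q0) + /(_ (lt_trans pn nd) p0).
  rewrite -/(quot f p x) -/(quot f q x) !ltr_norml ler_norml.
  move=> /andP[q1 q2] /andP[p1 p2]; apply/andP; split; move: q1 q2 p1 p2;
    set c := _^-1; set u : R := quot _ _ _; set v : R := quot _ _ _;
    set w : R := derive1 _ _; lra.
move=> fx; apply: cauchy_cvg; apply: cauchy_exP => e e0.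
have [m me] : exists m, m.+1%:R^-1 < e.
  exists (Num.truncn e^-1); rewrite invf_plt ?posrE//.
  by rewrite truncnS_gt.
have [n _ fn] := fx m Logic.I.
have n0 : 0 < n.+1%:R^-1 :> R by rewrite invr_gt0.
(* Any nonzero increment below [n.+1%:R^-1] would serve here: its quotient is the centre of a ball
   of radius [e] containing all later ones. *)
exists (quot f (n.+1%:R^-1 / 2) x).
exists n.+1%:R^-1 => //= k; rewrite /= sub0r normrN => kn k0.
have := fn (n.+1%:R^-1 / 2, k); rewrite /= /quot [_ *: 1]mulr1 => {}fn.
apply: le_lt_trans me; apply: fn; split => //.
by rewrite ger0_norm ?divr_ge0// ltr_pdivrMr// ltr_pMr// ltr1n.
Qed.

Lemma measurable_derivable f : continuous f ->
  measurable [set x | derivable f x 1].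
Proof.
move=> cf; rewrite derivableE; apply: bigcapT_measurable => m.
apply: bigcupT_measurable => n; apply: closed_measurable.
apply: closed_bigI => -[p q] _ /=.
apply: (@closed_comp _ _ (fun x => `|quot f p x - quot f q x|)
  [set y | y <= m.+1%:R^-1]); last exact: closed_le.
move=> x _; apply: cvg_norm; apply: cvgB; exact: quot_continuous.
Qed.

Lemma measurable_derive1 f (D : set R) : continuous f ->
  measurable_fun D (derive1 f).
Proof.
move=> cf; apply: measurable_funTS.
have mS := measurable_derivable cf.
rewrite -(setUv [set x | derivable f x 1]).
apply/measurable_funU => //; first exact: measurableC.
split.
  (* Where [f] is derivable, the derivative is the limit of continuous quotients along the nonzero
     increments [n.+1%:R^-1]. *)
  apply: (@measurable_fun_cvg _ _ _ _ (fun n => quot f n.+1%:R^-1)).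
    move=> n; apply: measurable_funTS; apply: continuous_measurable_fun.
    exact: quot_continuous.
  move=> x /derivable_derive1_cvg fx.
  have inv0 : (n.+1%:R^-1 : R) @[n --> \oo] --> 0^'.
    move=> A /= A0.
    have : \forall n \near \oo, n.+1%:R^-1 != 0 :> R -> A n.+1%:R^-1.
      exact: (@cvg_harmonic R _ A0).
    by apply: filterS => n; apply; rewrite invr_neq0.
  exact: cvg_comp inv0 fx.
(* Where the quotients diverge, their limit is by convention the default [point], so [derive1 f] is
   constant there. *)
apply: (@eq_measurable_fun _ _ _ _ _ (cst point)); last exact: measurable_cst.
move=> x; rewrite inE /= => ndf; apply/esym/dvgP => cvgf; apply: ndf.
by move: cvgf; rewrite /derivable; under [in X in _ -> X]eq_fun do
  rewrite /= [_ *: 1]mulr1.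
Qed.

End MeasurableDerivative.

(** * Roots of expanding functions and uniform estimates for the class [Hclass] *)

Section ImplicitFunction.
Context {R : realType}.
Local Notation mu := (@lebesgue_measure R).
Implicit Types (f g h : R -> R) (a b x y : R).

Lemma deriv_within_is_derive f a b x l : a < x < b ->
  deriv_within `[a, b] f x l -> is_derive x 1 f l.
Proof.
move=> /andP[ax xb] fxl.
have cl : h^-1 *: ((f \o shift x) (h *: 1) - f x) @[h --> 0^'] --> l.
  move=> A Al; have := fxl A Al.
  have ab : \forall h \near 0^', `[a, b]%classic (x + h).
    near=> h; rewrite /= in_itv/=; apply/andP; split.
      rewrite -lerBlDl ltW//; near: h; apply: nbhs_dnbhs; apply: lt_nbhsr.
      by rewrite subr_lt0.
    rewrite -lerBrDl ltW//; near: h; apply: nbhs_dnbhs; apply: lt_nbhsl.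
    by rewrite subr_gt0.
  rewrite /= nbhs_simpl/= /within/= => fA.
  move: ab fA; apply: filterS2 => h ab /(_ ab).
  by rewrite /= [h *: 1]mulr1 [h + x]addrC.
split; first by apply/cvg_ex; exists l.
exact: cvg_lim cl.
Unshelve. all: by end_near. Qed.

Lemma is_derive_continuous_within f df a b :
  (forall y, a <= y <= b -> is_derive y 1 f (df y)) ->
  {within `[a, b], continuous f}.
Proof.
move=> fdf; apply: derivable_within_continuous => y; rewrite in_itv/= => yab.
by have [] := fdf y yab.
Qed.

Lemma is_derive_expanding f df a b k :
  (forall y, a <= y <= b -> is_derive y 1 f (df y)) ->
  (forall y, a <= y <= b -> k <= df y) ->
  forall y z, a <= y -> y <= z -> z <= b -> k * (z - y) <= f z - f y.
Proof.
move=> fdf kdf y z ay; rewrite le_eqVlt => /predU1P[<-|yz zb].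
  by rewrite !subrr mulr0.
have sub t : y <= t <= z -> a <= t <= b.
  by move=> /andP[yt tz]; rewrite (le_trans ay)//= (le_trans tz).
have [||c] := @MVT R f df y z yz.
- by move=> t; rewrite in_itv/= => /andP[yt tz]; apply: fdf; rewrite sub ?ltW.
- by apply: is_derive_continuous_within => t /sub; exact: fdf.
rewrite in_itv/= => /andP[yc cz] ->; apply: ler_wpM2r.
  by rewrite subr_ge0 ltW.
by apply: kdf; rewrite sub ?ltW.
Qed.

(** From 0 to [r] the function gains at least [k * r], more than [|f 0|], and symmetrically on the
    left. The end values thus have opposite signs and the intermediate value theorem applies. *)
Lemma is_derive_expanding_root f df r k : 0 < r ->
  (forall y, - r <= y <= r -> is_derive y 1 f (df y)) ->
  (forall y, - r <= y <= r -> k <= df y) -> `|f 0| < k * r ->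
  exists y, - r < y < r /\ f y = 0.
Proof.
move=> r0 fdf kdf; rewrite ltr_norml => /andP[fkr fkr'].
have expand := is_derive_expanding fdf kdf.
have fr : 0 < f r.
  by have := expand 0 r; rewrite subr0; move=> /(_ _ _ _)/wrap[]; lra.
have fNr : f (- r) < 0.
  by have := expand (- r) 0; rewrite sub0r opprK; move=> /(_ _ _ _)/wrap[]; lra.
have [|||y] := @IVT R f (- r) r 0.
- lra.
- exact: is_derive_continuous_within fdf.
- by rewrite ge_min le_max (ltW fr) (ltW fNr) orbT.
rewrite in_itv/= => /andP[ry yr] fy0; exists y; split => //.
rewrite !lt_neqAle ry yr !andbT; apply/andP; split; apply/eqP => yE.
  by move: fNr; rewrite yE fy0 ltxx.
by move: fr; rewrite -yE fy0 ltxx.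
Qed.

Lemma L2_on_le (D D' : set R) (u v : R -> R) (c : R) : measurable D -> measurable D' ->
  D `<=` D' -> measurable_fun D u -> L2_on D' v ->
  {ae mu, forall x, D x -> `|u x| <= c * `|v x|} -> L2_on D u.
Proof.
move=> mD mD' DD' m_u [mv iv] uv; split => //.
have mvD : measurable_fun D v by exact: measurable_funS mv.
have msqr (w : R -> R) (E : set R) : measurable_fun E w ->
    measurable_fun E (fun x => (`|w x| ^+ 2)%:E).
  move=> mw; apply/measurable_EFinP/measurable_funX.
  exact: measurableT_comp.
have := @ae_ge0_le_integral _ _ R mu D mD (fun x => (`|u x| ^+ 2)%:E)
  (fun x => ((c ^+ 2)%:E * (`|v x| ^+ 2)%:E)%E).
move=> /(_ _ _ _ _ _)/wrap[].
- by move=> x _; rewrite lee_fin exprn_ge0.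
- exact: msqr.
- by move=> x _; rewrite -EFinM lee_fin mulr_ge0 ?sqr_ge0.
- by apply: emeasurable_funM => //; exact: msqr.
- move: uv; apply: filterS; first exact: (ae_filter_ringOfSetsType mu).
  move=> x uv Dx; rewrite -EFinM lee_fin -exprMn ler_sqr ?nnegrE ?uv//.
  by rewrite (le_trans _ (uv Dx)).
move=> /le_lt_trans; apply.
rewrite ge0_integralZl//=; last 2 first.
- exact: msqr.
- by rewrite lee_fin sqr_ge0.
apply: lte_mul_pinfty => //; first by rewrite lee_fin sqr_ge0.
apply: le_lt_trans iv; apply: ge0_subset_integral => //.
exact: msqr.
Qed.

(** Condition (iii) supplies one [g] for all [y]. Extending it by zero outside [[a, b]] gives an
    integrable function on the line. *)
Lemma Hclass_increment (I2 : set R) (F : R -> R -> R) a b : a <= b ->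
  Hclass `[a, b] I2 F ->
  exists g : R -> R, [/\ L2_on `[a, b] g,
    mu.-integrable setT (EFin \o (g \_ `[a, b])) &
    forall y, I2 y -> forall x x', a <= x -> x <= x' -> x' <= b ->
      `|F x' y - F x y| <= \int[mu]_(t in `]x, x']) `|(g \_ `[a, b]) t| ].
Proof.
move=> ab [_ [FH1 [g L2g Fg]]]; exists g.
have ig := L2_on_integrable L2g.
split => // y Iy x x' ax xx' x'b.
have [acF _] := FH1 _ Iy.
apply: (abs_cont_increment_le (f := F ^~ y) ab acF ig) => //.
have := Fg _ Iy; apply: filterS; first exact: (ae_filter_ringOfSetsType mu).
by move=> t Ft tab; rewrite patchE mem_set//; exact: Ft.
Qed.

(* The modulus of continuity of [F ^~ y] provided by condition (iii) is uniform
   in [y]. *)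
Lemma Hclass_uniform (I2 : set R) (F : R -> R -> R) a b : a <= b ->
  Hclass `[a, b] I2 F -> forall e : R, 0 < e -> exists2 d : R, 0 < d &
    forall y, I2 y -> forall x x', a <= x <= b -> a <= x' <= b ->
      `|x' - x| < d -> `|F x' y - F x y| < e.
Proof.
move=> ab /(Hclass_increment ab)[g [_ ig Fg]] e e0.
have [d [d0 dP]] := integral_normr_continuous ig e0; exists d => // y Iy.
suff H x x' : a <= x <= b -> a <= x' <= b -> x <= x' -> x' - x < d ->
    `|F x' y - F x y| < e.
  move=> x x' xab x'ab; have [xx'|/ltW x'x] := leP x x'.
    by rewrite ger0_norm ?subr_ge0//; exact: H.
  by rewrite ler0_norm ?subr_le0// opprB distrC; exact: H.
move=> /andP[ax _] /andP[_ x'b] xx' x'xd.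
apply: le_lt_trans (Fg _ Iy _ _ ax xx' x'b) _; apply: dP.
  exact: measurable_itv.
rewrite [ltLHS]lebesgue_measure_itv/=; case: ifPn => _; last by rewrite lte_fin.
by rewrite -EFinB lte_fin.
Qed.

End ImplicitFunction.

(** * The implicit function theorem *)

Theorem theorem5p5 (R : realType) (F Fy : R -> R -> R) :
  partial_y `[-1, 1] `[-1, 1] F Fy ->
  Hclass `[-1, 1] `[-1, 1] F ->
  Hclass `[-1, 1] `[-1, 1] Fy ->
  F 0 0 = 0 ->
  Fy 0 0 != 0 ->
  exists a1 b1 a2 b2 : R,
    [/\ a1 < 0 < b1, a2 < 0 < b2,
        `]a1, b1[ `<=` `[-1, 1], `]a2, b2[ `<=` `[-1, 1] &
     exists f : R -> R,
       [/\ H1 `]a1, b1[ f,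
           f @` `]a1, b1[ `<=` `]a2, b2[,
           (forall x y, x \in `]a1, b1[ -> y \in `]a2, b2[ ->
              (F x y = 0 <-> y = f x)) &
           (forall f' : R -> R,
              H1 `]a1, b1[ f' ->
              f' @` `]a1, b1[ `<=` `]a2, b2[ ->
              (forall x y, x \in `]a1, b1[ -> y \in `]a2, b2[ ->
                 (F x y = 0 <-> y = f' x)) ->
              forall x, x \in `]a1, b1[ -> f' x = f x)]].
Proof.
move=> Fyd HF HFy F00; set m := Fy 0 0 => m0.
have N11 : -1 <= 1 :> R by lra.
have I0 : `[-1, 1]%classic (0 : R) by rewrite /= in_itv/=; apply/andP; split; lra.
have dF (x y : R) : -1 <= x <= 1 -> -1 < y < 1 -> is_derive y 1 (F x) (Fy x y).
  move=> xI yI; apply: (deriv_within_is_derive yI).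
  have yI' : -1 <= y <= 1 by case/andP: yI => /ltW -> /ltW ->.
  by apply: Fyd; rewrite /= in_itv.
have m40 : 0 < `|m| / 4 by rewrite divr_gt0 ?normr_gt0.
have [r [r0 r1 Fyr]] : exists r, [/\ 0 < r, r < 1 &
    forall y : R, `|y| <= r -> `|Fy 0 y - m| < `|m| / 4].
  (* Condition (i) for [Fy] makes [Fy 0] differentiable, hence continuous, at 0. *)
  have [Fyy [dFyy _]] := HFy.1 0 I0.
  have dFy0 : is_derive (0 : R) 1 (Fy 0) (Fyy 0).
    by apply: (deriv_within_is_derive (a := -1) (b := 1)); [lra|exact: dFyy].
  have cFy0 : {for (0 : R), continuous (Fy 0)}.
    by apply/differentiable_continuous/derivable1_diffP.
  have /cvgrPdist_lt/(_ _ m40)[e /= e0 eP] := cFy0.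
  exists (Num.min (e / 2) (1 / 2)); split.
  - by rewrite lt_min !divr_gt0.
  - by rewrite gt_min; apply/orP; right; lra.
  - move=> y; rewrite le_min => /andP[ye _]; rewrite distrC; apply: eP.
    by rewrite /= sub0r normrN; move: ye e0; lra.
have [s1 s10 Fys1] := Hclass_uniform N11 HFy m40.
(* After division by [m], this tolerance on [F x 0] becomes [2^-1 * r], the bound that
   [is_derive_expanding_root] requires for slope 1/2. *)
have mr0 : 0 < `|m| * (r / 2) by rewrite mulr_gt0 ?normr_gt0 ?divr_gt0.
have [s2 s20 Fs2] := Hclass_uniform N11 HF mr0.
have [s [s0 s_lt1 ss1 ss2]] : exists s, [/\ 0 < s, s < 1, s < s1 & s < s2].
  exists (Num.min (1 / 2) (Num.min (s1 / 2) (s2 / 2))); split.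
  - by rewrite !lt_min !divr_gt0.
  - by rewrite !gt_min; apply/orP; left; lra.
  - by rewrite !gt_min; apply/orP; right; apply/orP; left; move: s10; lra.
  - by rewrite !gt_min; apply/orP; right; apply/orP; right; move: s20; lra.
have sI (x : R) : - s <= x <= s -> -1 <= x <= 1.
  by move=> /andP[*]; apply/andP; split; lra.
have rI (y : R) : - r <= y <= r -> -1 < y < 1.
  by move=> /andP[*]; apply/andP; split; lra.
(* The slope of [F x] is within [`|m| / 2] of [m], so that [F x / m] has slope
   at least 1/2. *)
pose G x y := m^-1 * F x y.
have dG (x : R) : - s <= x <= s -> forall y, - r <= y <= r ->
    is_derive y 1 (G x) (m^-1 * Fy x y).
  move=> /sI xI y /rI yI; have dFxy := dF _ _ xI yI.
  rewrite /G; exact: (is_deriveZ m^-1).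
have slope (x : R) : - s <= x <= s -> forall y, - r <= y <= r -> 2^-1 <= m^-1 * Fy x y.
  move=> xs y yr.
  have yI : `[-1, 1]%classic y.
    by rewrite /= in_itv/=; have /andP[/ltW -> /ltW ->] := rI _ yr.
  have x0 : `|x - 0| < s1.
    by rewrite subr0; apply: le_lt_trans ss1; rewrite ler_norml.
  have F1 : `|Fy x y - Fy 0 y| < `|m| / 4.
    by apply: Fys1 => //; exact: sI.
  have F2 : `|Fy 0 y - m| < `|m| / 4 by apply: Fyr; rewrite ler_norml.
  have F3 : `|Fy x y - m| <= `|m| / 2.
    have := ler_normD (Fy x y - Fy 0 y) (Fy 0 y - m); rewrite subrKA.
    by move: F1 F2; lra.
  have : `|m^-1 * Fy x y - 1| <= 2^-1.
    rewrite -[X in `|_ - X|](mulVf m0) -mulrBr normrM normfV ler_pdivrMl ?normr_gt0//.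
  by rewrite ler_norml => /andP[+ _]; lra.
(* The condition on [x] is placed under the existential so that [choice] yields a total function
   [phi]; outside [[-s, s]] the value 0 is a dummy. *)
have root (x : R) : exists y, - s <= x <= s -> - r < y < r /\ F x y = 0.
  have [xs|xs] := boolP (- s <= x <= s); last by exists 0.
  have [|y [yr Gy]] := is_derive_expanding_root r0 (dG _ xs) (slope _ xs).
    rewrite /G normrM normfV ltr_pdivrMl ?normr_gt0//.
    have := Fs2 0 I0 0 x; rewrite F00 !subr0 [2^-1 * r]mulrC; apply.
    - lra.
    - exact: sI.
    - by apply: le_lt_trans ss2; rewrite ler_norml.
  exists y => _; split => //; move/eqP: Gy.
  by rewrite /G mulf_eq0 invr_eq0 (negbTE m0)/= => /eqP.
have {root} [phi phiP] := choice root.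
have phi_uniq (x y : R) : - s <= x <= s -> - r < y < r -> F x y = 0 -> y = phi x.
  move=> xs yr Fxy0; have [pr Fp0] := phiP _ xs.
  have := is_derive_expanding (dG _ xs) (slope _ xs).
  have [yp|py|//] := ltgtP y (phi x).
    move=> /(_ y (phi x)); rewrite /G Fp0 Fxy0 mulr0 subrr.
    by move: yr pr => /andP[? ?] /andP[? ?] /(_ _ _ _)/wrap[]; lra.
  move=> /(_ (phi x) y); rewrite /G Fp0 Fxy0 mulr0 subrr.
  by move: yr pr => /andP[? ?] /andP[? ?] /(_ _ _ _)/wrap[]; lra.
have [g [L2g ig Fg]] := Hclass_increment N11 HF.
(* The factor 2 inverts the slope bound 1/2 of [G], and [1 / |m|] comes from the normalisation of
   [F]. *)
pose c := 2 / `|m|; have c0 : 0 < c by rewrite divr_gt0 ?normr_gt0.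
pose cg t := c * (g \_ `[-1, 1]) t.
have icg : (@lebesgue_measure R).-integrable setT (EFin \o cg).
  exact: (integrableZl measurableT c ig).
have phi_incr (x y : R) : - s <= x -> x <= y -> y <= s ->
    `|phi y - phi x| <= \int[(@lebesgue_measure R)]_(t in `]x, y]) `|cg t|.
  move=> sx xy ys.
  have xs : - s <= x <= s by lra.
  have {}ys : - s <= y <= s by lra.
  have [pxr Fpx] := phiP _ xs; have [pyr Fpy] := phiP _ ys.
  (* Since [F x (phi x) = 0], this value is an increment of [F] in its first argument alone. *)
  have Fxy : `|F y (phi x)| <=
      \int[(@lebesgue_measure R)]_(t in `]x, y]) `|(g \_ `[-1, 1]) t|.
    rewrite -[F y _]subr0 -Fpx; apply: Fg => //; last 2 first.
    - by have /andP[] := sI _ xs.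
    - by have /andP[] := sI _ ys.
    by rewrite /= in_itv/=; have /andP[/ltW -> /ltW ->] := rI (phi x) ltac:(lra).
  (* Now the first argument [y] is fixed: [G y] vanishes at [phi y] and expands distances by at
     least 1/2. *)
  have expand : 2^-1 * `|phi y - phi x| <= `|m|^-1 * `|F y (phi x)|.
    have := is_derive_expanding (dG _ ys) (slope _ ys).
    have [yx|/ltW xy'] := leP (phi y) (phi x).
      move=> /(_ (phi y) (phi x)); rewrite /G Fpy mulr0 subr0.
      rewrite -normfV -normrM distrC.
      rewrite (ger0_norm (_ : 0 <= phi x - phi y)) ?subr_ge0// => H.
      by apply: (le_trans _ (ler_norm _)); apply: H; lra.
    move=> /(_ (phi x) (phi y)); rewrite /G Fpy mulr0 sub0r.
    rewrite -normfV -normrM -[`|_ * F _ _|]normrN.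
    rewrite (ger0_norm (_ : 0 <= phi y - phi x)) ?subr_ge0// => H.
    by apply: (le_trans _ (ler_norm _)); apply: H; lra.
  under eq_Rintegral do rewrite /cg normrM (gtr0_norm c0).
  rewrite RintegralZl//; last first.
    apply: integrable_norm; apply: integrableS ig => //; exact: measurable_itv.
  apply: le_trans (ler_wpM2l (ltW c0) Fxy).
  by rewrite /c -mulrA -ler_pdivrMl// mulrC.
have Nss : - s <= s by lra.
(* Clamping makes the solution continuous on the whole line, as [measurable_derive1] demands,
   without changing it on [[-s, s]]. *)
pose f := phi \o clamp (- s) s.
have fE (x : R) : - s <= x <= s -> f x = phi x by move=> xs; rewrite /f /= clamp_id.
have acf : abs_cont_on setT f.
  exact/(abs_cont_on_clamp Nss)/(increment_le_abs_cont icg).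
have cf := abs_cont_on_continuous acf.
have fr x : - r < f x < r.
  by have [] := phiP (clamp (- s) s x) (clamp_itv x Nss).
have mss : measurable (`]- s, s[%classic : set R) by exact: measurable_itv.
have m11 : measurable (`[-1, 1]%classic : set R) by exact: measurable_itv.
have s11 : `]- s, s[ `<=` `[-1, 1].
  by move=> x /=; rewrite !in_itv/= => /andP[*]; apply/andP; split; lra.
have fF (x y : R) : x \in `]- s, s[ -> y \in `]- r, r[ -> F x y = 0 <-> y = f x.
  rewrite !in_itv/= => /andP[/ltW sx /ltW xs] yr.
  have {sx} xs : - s <= x <= s by rewrite sx.
  rewrite fE//; split; first exact: phi_uniq.
  by move=> ->; have [] := phiP _ xs.
exists (- s), s, (- r), r; split => //.
- by rewrite oppr_lt0 s0.
- by rewrite oppr_lt0 r0.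
- by move=> y /=; rewrite !in_itv/= => /andP[*]; apply/andP; split; lra.
exists f; split => //.
- split; first exact: abs_cont_on_sub acf.
  split.
    apply: (L2_on_le mss m11 s11 (v := cst 1) (c := r)).
    + by apply: measurable_funTS; exact: continuous_measurable_fun.
    + split; first exact: measurable_cst.
      rewrite (eq_integral (cst 1%:E)); last first.
        by move=> x _ /=; rewrite normr1 expr1n.
      rewrite integral_cst//= mul1e lebesgue_measure_itv/=.
      by case: ifPn => // _; rewrite -EFinB ltry.
    + apply: aeW => x _ /=; rewrite normr1 mulr1 ler_norml.
      by have /andP[/ltW -> /ltW ->] := fr x.
  apply: (L2_on_le mss m11 s11 (v := g) (c := c)) => //.
    exact: measurable_derive1.
  have : {ae (@lebesgue_measure R), forall x, - s < x < s ->
      `|derive1 f x| <= `|cg x| }.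
    apply: (increment_le_derive_ae Nss (abs_cont_on_sub (@subsetT _ _) acf) icg).
    move=> x y sx xy ys; rewrite !fE; [exact: phi_incr|lra|lra].
  apply: filterS; first exact: (ae_filter_ringOfSetsType (@lebesgue_measure R)).
  move=> x fx xs; have := fx xs; rewrite /cg normrM (gtr0_norm c0) patchE mem_set//.
  exact: s11.
- by move=> _ [x _ <-]; rewrite /= in_itv/=.
(* Here [f'] is a competing solution, not a derivative: its value at [x] is a zero of [F x] in []-r,
   r[], and [fF] identifies that zero as [f x]. *)
- move=> f' _ f'r f'F x xs.
  have f'x : f' x \in `]- r, r[ by apply: f'r; exists x.
  by apply/(fF _ _ xs f'x)/(f'F _ _ xs f'x).
Qed.
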